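(* Let $p\ge5$ be a prime with Legendre symbol $\left(\frac{-3}{p}\right)=-1$, and let $m\ge0$, $\alpha\ge0$, $n\ge0$ be integers. Then for every $i\in\{1,2,\dots,p-1\}$, $$\overline{S}_9^{\,4m+1}\big(6p^{2\alpha+2}n+(6i+p)p^{2\alpha+1}\big)\equiv0\pmod{8}.$$
   Context: For $|q|<1$ and a positive integer $k$, write $f_k=\prod_{j\ge1}(1-q^{kj})$. For a positive integer $r$, $\overline{S}_9^{\,r}(n)$ (number of $9$-Schur overpartitions of $n$ with $r$-tuples) is defined by $\sum_{n\ge0}\overline{S}_9^{\,r}(n)q^n=\prod_{n\ge1}\frac{(1+q^{2n-1})^r(1-q^{9(2n-1)})^r}{(1+q^{9(2n-1)})^r(1-q^{2n-1})^r}=\frac{f_2^{3r}f_9^{2r}f_{36}^r}{f_1^{2r}f_4^rf_{18}^{3r}}$. *)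

(* Defs.v *)
From HB Require Import structures.
From mathcomp Require Import all_boot all_order all_algebra.
From mathcomp Require Import boolp classical_sets.

Set Implicit Arguments.
Unset Strict Implicit.
Unset Printing Implicit Defensive.

Import GRing.Theory.
Local Open Scope ring_scope.

Record fps (R : Type) := Fps { fps_coef :> nat -> R }.

Lemma fpsP (R : Type) (a b : fps R) : a =1 b -> a = b.
Proof. by case: a b => [a] [b] /= /funext->. Qed.

HB.instance Definition _ (R : Type) := gen_eqMixin (fps R).
HB.instance Definition _ (R : Type) := gen_choiceMixin (fps R).

Section FpsRing.
Variable R : comNzRingType.
Implicit Types a b c : fps R.

Definition fps_zero : fps R := Fps (fun=> 0).
Definition fps_opp a : fps R := Fps (fun n => - a n).
Definition fps_add a b : fps R := Fps (fun n => a n + b n).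
Definition fps_one : fps R := Fps (fun n => (n == 0)%:R).
Definition fps_mul a b : fps R := Fps (fun n => \sum_(i < n.+1) a i * b (n - i)%N).

Fact fps_addA : associative fps_add.
Proof. by move=> a b c; apply: fpsP => n /=; rewrite addrA. Qed.
Fact fps_addC : commutative fps_add.
Proof. by move=> a b; apply: fpsP => n /=; rewrite addrC. Qed.
Fact fps_add0 : left_id fps_zero fps_add.
Proof. by move=> a; apply: fpsP => n /=; rewrite add0r. Qed.
Fact fps_addN : left_inverse fps_zero fps_opp fps_add.
Proof. by move=> a; apply: fpsP => n /=; rewrite addNr. Qed.

HB.instance Definition _ :=
  GRing.isZmodule.Build (fps R) fps_addA fps_addC fps_add0 fps_addN.

Definition fps_trunc n a : {poly R} := \poly_(i < n) a i.

Lemma fps_mul_trunc N n a b :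
  (n < N)%N -> fps_mul a b n = (fps_trunc N a * fps_trunc N b)`_n.
Proof.
move=> nN; rewrite coefM; apply: eq_bigr => i _.
rewrite !coef_poly (leq_ltn_trans _ nN) ?leq_ord //.
by rewrite (leq_ltn_trans (leq_subr _ _) nN).
Qed.

Fact fps_mulC : commutative fps_mul.
Proof.
by move=> a b; apply: fpsP => n; rewrite !(fps_mul_trunc _ _ (leqnn n.+1)) mulrC.
Qed.

Fact fps_mulA : associative fps_mul.
Proof.
have mulAl a b c n : fps_mul (fps_mul a b) c n =
    (fps_trunc n.+1 a * fps_trunc n.+1 b * fps_trunc n.+1 c)`_n.
  rewrite coefM; apply: eq_bigr => i _; congr (_ * _).
    by rewrite -fps_mul_trunc.
  by rewrite coef_poly ltnS leq_subr.
move=> a b c; rewrite [LHS]fps_mulC; apply: fpsP => n.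
by rewrite !mulAl mulrC mulrA.
Qed.

Fact fps_mul1 : left_id fps_one fps_mul.
Proof.
move=> a; apply: fpsP => n /=; rewrite big_ord_recl /= mul1r subn0.
by rewrite big1 ?addr0 // => i _; rewrite mul0r.
Qed.

Fact fps_mulDl : left_distributive fps_mul fps_add.
Proof.
move=> a b c; apply: fpsP => n /=; rewrite -big_split /=.
by apply: eq_bigr => i _; rewrite mulrDl.
Qed.

Fact fps_one_neq0 : fps_one != 0.
Proof.
apply/eqP => /(congr1 (fun a : fps R => a 0%N)) /eqP.
by rewrite /= oner_eq0.
Qed.

HB.instance Definition _ := GRing.Zmodule_isComNzRing.Build (fps R)
  fps_mulA fps_mulC fps_mul1 fps_mulDl fps_one_neq0.

Definition fpsX : fps R := Fps (fun n => (n == 1)%:R).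

Lemma coef_fps0 n : (0 : fps R) n = 0. Proof. by []. Qed.
Lemma coef_fps1 n : (1 : fps R) n = (n == 0)%:R. Proof. by []. Qed.
Lemma coef_fpsD a b n : (a + b) n = a n + b n. Proof. by []. Qed.
Lemma coef_fpsN a n : (- a) n = - a n. Proof. by []. Qed.
Lemma coef_fpsM a b n : (a * b) n = \sum_(i < n.+1) a i * b (n - i)%N.
Proof. by []. Qed.

Lemma coef_fpsXM a n : (fpsX * a) n = if n is m.+1 then a m else 0.
Proof.
rewrite coef_fpsM big_ord_recl /= mul0r add0r.
case: n => [|n]; first by rewrite big_ord0.
rewrite big_ord_recl /= mul1r subSS subn0 big1 ?addr0 // => i _.
exact: mul0r.
Qed.

Lemma coef_fpsXn k n : (fpsX ^+ k) n = (n == k)%:R.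
Proof.
by elim: k n => [|k IHk] [|n] //; rewrite exprS coef_fpsXM.
Qed.

End FpsRing.

Section FpsUnitRing.
Variable R : comUnitRingType.
Implicit Types a b : fps R.

Definition fps_unit : pred (fps R) := fun a => a 0 \is a GRing.unit.

(* The list of the first n coefficients of 1 / a. *)
Fixpoint fps_inv_seq a n : seq R :=
  if n is m.+1 then
    let s := fps_inv_seq a m in
    rcons s ((a 0)^-1 * ((m == 0)%:R - \sum_(i < m) s`_i * a (m - i)%N))
  else [::].

Definition fps_inv a : fps R :=
  if fps_unit a then Fps (fun n => (fps_inv_seq a n.+1)`_n) else a.

Lemma size_fps_inv_seq a n : size (fps_inv_seq a n) = n.
Proof. by elim: n => //= n IHn; rewrite size_rcons IHn. Qed.

Lemma nth_fps_inv_seq a n i :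
  (i < n)%N -> (fps_inv_seq a n)`_i = (fps_inv_seq a i.+1)`_i.
Proof.
elim: n => // n IHn; rewrite ltnS leq_eqVlt => /predU1P[-> // | lt_in].
by rewrite [LHS]/= nth_rcons size_fps_inv_seq lt_in IHn.
Qed.

Fact fps_mulVx : {in fps_unit, left_inverse 1 fps_inv *%R}.
Proof.
move=> a ua; have ua0 : a 0 \is a GRing.unit := ua.
rewrite /fps_inv (ua : fps_unit a); apply: fpsP => n.
rewrite coef_fpsM big_ord_recr /= nth_rcons size_fps_inv_seq ltnn eqxx subnn.
rewrite [_ * a 0]mulrC mulVKr // addrC.
rewrite [X in _ + X](eq_bigr (fun i : 'I_n =>
  (fps_inv_seq a n)`_i * a (n - i)%N)) ?subrK // => i _.
by rewrite [in RHS]nth_fps_inv_seq.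
Qed.

Fact fps_unitPl a b : b * a = 1 -> fps_unit a.
Proof.
move/(congr1 (fun c : fps R => c 0%N)).
rewrite coef_fpsM big_ord1 coef_fps1 => ba1.
by apply/unitrP; exists (b 0); rewrite ba1 mulrC ba1.
Qed.

Fact fps_invr_out : {in [predC fps_unit], fps_inv =1 id}.
Proof. by move=> a /negPf ua; rewrite /fps_inv (ua : fps_unit a = false). Qed.

HB.instance Definition _ := GRing.ComNzRing_hasMulInverse.Build (fps R)
  fps_mulVx fps_unitPl fps_invr_out.

Lemma fps_unitE a : (a \is a GRing.unit) = (a 0 \is a GRing.unit).
Proof. by []. Qed.

(* Coefficientwise (X-adic) convergence of the partial products over 1 <= k < M. *)
Definition is_fps_prod (F : nat -> fps R) (P : fps R) : Prop :=
  forall n, exists N, forall M, (N <= M)%N -> (\prod_(1 <= k < M) F k) n = P n.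

(* The product of the F k for k >= 1; it is 0 if the product diverges. *)
Definition fps_prod (F : nat -> fps R) : fps R :=
  xget 0 [set P | is_fps_prod F P]%classic.

Lemma is_fps_prod_unique F P Q : is_fps_prod F P -> is_fps_prod F Q -> P = Q.
Proof.
move=> FP FQ; apply: fpsP => n; have [N PN] := FP n; have [N' QN'] := FQ n.
by rewrite -(PN (maxn N N')) ?leq_maxl // QN' // leq_maxr.
Qed.

Lemma fps_prodE F P : is_fps_prod F P -> fps_prod F = P.
Proof.
by move=> FP; apply: xget_unique => // Q /is_fps_prod_unique; apply.
Qed.

Definition fps_eqmod n a b := forall i, (i < n)%N -> a i = b i.

Lemma fps_eqmodM n a a' b b' :
  fps_eqmod n a a' -> fps_eqmod n b b' -> fps_eqmod n (a * b) (a' * b').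
Proof.
move=> eq_a eq_b i lt_in; rewrite !coef_fpsM; apply: eq_bigr => j _.
rewrite eq_a ?eq_b ?(leq_ltn_trans (leq_subr _ _) lt_in) //.
by apply: leq_ltn_trans lt_in; rewrite leq_ord.
Qed.

Lemma fps_eqmodX n r a : fps_eqmod n a 1 -> fps_eqmod n (a ^+ r) 1.
Proof.
move=> eq_a; elim: r => [|r IHr] //; rewrite exprS -[1]mulr1.
exact: fps_eqmodM.
Qed.

Lemma fps_eqmod_div n a b : b \is a GRing.unit ->
  fps_eqmod n a 1 -> fps_eqmod n b 1 -> fps_eqmod n (a / b) 1.
Proof.
move=> ub eq_a eq_b i lt_in; rewrite -eq_a // -[in RHS](divrK ub a).
rewrite -[in LHS](mulr1 (a / b)).
by apply: (@fps_eqmodM n) => // j lt_jn; rewrite eq_b.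
Qed.

Lemma fps_prod_cvg (F : nat -> fps R) :
  (forall n k, (n < k)%N -> fps_eqmod n.+1 (F k) 1) -> is_fps_prod F (fps_prod F).
Proof.
move=> F1; pose P := Fps (fun n => (\prod_(1 <= k < n.+1) F k) n).
suff FP : is_fps_prod F P by rewrite (fps_prodE FP).
move=> n; exists n.+1 => M lt_nM; rewrite (big_cat_nat _ lt_nM) //=.
rewrite -[in RHS](mulr1 (\prod_(1 <= k < n.+1) F k)).
apply: (@fps_eqmodM n.+1) => //; rewrite big_nat_cond.
elim/big_rec: _ => // k a /andP[/andP[lt_nk _] _] eq_a.
by rewrite -[1]mulr1; apply: fps_eqmodM eq_a; apply: F1.
Qed.

End FpsUnitRing.

Local Notation q := (fpsX int).

Definition schur9_factor (r n : nat) : fps int :=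
  ((1 + q ^+ (2 * n - 1)) ^+ r * (1 - q ^+ (9 * (2 * n - 1))) ^+ r) /
  ((1 + q ^+ (9 * (2 * n - 1))) ^+ r * (1 - q ^+ (2 * n - 1)) ^+ r).

(* The n-th coefficient counts the 9-Schur overpartitions of n with r-tuples;
   the product converges by schur9_prod_cvg below. *)
Definition schur9_overpartitions (r : nat) : nat -> int :=
  fps_prod (schur9_factor r).

Lemma schur9_prod_cvg r :
  is_fps_prod (schur9_factor r) (fps_prod (schur9_factor r)).
Proof.
apply: fps_prod_cvg => n k lt_nk.
have eqD m : (n < m)%N -> fps_eqmod n.+1 (1 + q ^+ m) 1.
  move=> lt_nm i lt_in; rewrite coef_fpsD coef_fpsXn.
  by rewrite ltn_eqF ?addr0 // (leq_trans lt_in).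
have eqB m : (n < m)%N -> fps_eqmod n.+1 (1 - q ^+ m) 1.
  move=> lt_nm i lt_in; rewrite coef_fpsD coef_fpsN coef_fpsXn.
  by rewrite ltn_eqF ?subr0 // (leq_trans lt_in).
have lt1 : (n < 2 * k - 1)%N.
  by rewrite mul2n -addnn -addnBA ?(leq_trans _ lt_nk) // ltn_addr.
have lt9 : (n < 9 * (2 * k - 1))%N by rewrite (leq_trans lt1) // leq_pmull.
have eqM1 a b : fps_eqmod n.+1 a 1 -> fps_eqmod n.+1 b 1 ->
    fps_eqmod n.+1 (a * b) (1 : fps int).
  by move=> a1 b1; rewrite -[1]mulr1; apply: fps_eqmodM.
have eqden := eqM1 _ _ (fps_eqmodX r (eqD _ lt9))
                       (fps_eqmodX r (eqB _ lt1)).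
apply: fps_eqmod_div => //; first by rewrite fps_unitE eqden.
by apply: eqM1; apply: fps_eqmodX; [apply: eqD | apply: eqB].
Qed.

(* This is the Legendre symbol (a / p) only for p an odd prime. *)
Definition legendre (a : int) (p : nat) : int :=
  if (p %| a)%Z then 0
  else if [exists x : 'I_p, (x%:Z ^+ 2 == a %[mod p])%Z] then 1 else -1.

(* Main.v *)
(* Let P be the product, N = p^(2 alpha + 1) (6 p n + 6 i + p) and theta = q d/dq.
   Then theta P = P L, where L_b = 0 for even b and
   L_b = 2 r (sum of the d dividing b - 9 * sum of the d with 9 d dividing b)
   for odd b. Hence N P_N is the sum of the P_a L_b over a + b = N, and, N being
   odd, it is enough that 8 divides every term.
   - If a = 0, then 4 divides sigma(N): p is odd and has odd exponent in N, and the
     cofactor of that power is 2 mod 3, so that its sigma is even.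
   - If a > 0, both P_a and L_b are even. As N = 1 mod 3, either b <> 1 mod 3, in
     which case 4 divides L_b, or 3 divides a, in which case 4 divides P_a, as seen
     from P = 1 + 2 r (sum over odd d of q^d/(1 - q^d) + q^(9 d)/(1 - q^(9 d))) mod 4. *)
Require Import Defs.
From mathcomp Require Import all_boot all_order all_algebra.
From mathcomp Require Import all_fingroup all_solvable.
From mathcomp Require Import zify ring.

Import GRing.Theory.
Local Open Scope ring_scope.

Set Implicit Arguments.
Unset Strict Implicit.
Unset Printing Implicit Defensive.

(** * Logarithmic derivatives of power series and geometric series *)

Section LogarithmicDerivative.
Variable R : comUnitRingType.
Implicit Types a b u v : fps R.

Lemma coef_fps_sum (I : Type) (s : seq I) (P : pred I) (F : I -> fps R) n :
  (\sum_(i <- s | P i) F i) n = \sum_(i <- s | P i) F i n.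
Proof. by elim/big_rec2: _ => // i _ y _ <-. Qed.

Lemma coef_fpsMn a k n : (a *+ k) n = a n *+ k.
Proof. by elim: k => // k IHk; rewrite !mulrS -IHk. Qed.

Lemma coef_fpsXnM k a n :
  (fpsX R ^+ k * a) n = if (n < k)%N then 0 else a (n - k)%N.
Proof.
elim: k n => [|k IHk] n; first by rewrite mul1r subn0.
by rewrite exprS -mulrA coef_fpsXM; case: n => // n; rewrite IHk.
Qed.

Definition theta a : fps R := Fps (fun n => a n *+ n).

Lemma thetaM a b : theta (a * b) = theta a * b + a * theta b.
Proof.
apply: fpsP => n; rewrite coef_fpsD -[LHS]/((a * b) n *+ n) !coef_fpsM -sumrMnl -big_split.
apply: eq_bigr => i _ /=; rewrite mulrnAl mulrnAr -mulrnDr subnKC //.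
by rewrite -ltnS.
Qed.

Lemma theta1 : theta 1 = 0.
Proof. by apply: fpsP => -[|n] //=; rewrite mul0rn. Qed.

Lemma theta1DXn k : theta (1 + fpsX R ^+ k) = fpsX R ^+ k *+ k.
Proof.
apply: fpsP => n; rewrite coef_fpsMn /= coef_fpsXn.
have [-> | _] := eqVneq n k; first by case: k => [|k]; rewrite ?mulr0n ?coef_fps1 ?add0r.
by rewrite addr0 mul0rn; case: n => [|n]; rewrite ?mul0rn.
Qed.

Lemma theta1BXn k : theta (1 - fpsX R ^+ k) = - (fpsX R ^+ k *+ k).
Proof.
apply: fpsP => n; rewrite coef_fpsN coef_fpsMn /= coef_fpsXn.
have [-> | _] := eqVneq n k.
  by case: k => [|k]; rewrite ?mulr0n ?oppr0 // add0r mulNrn.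
by rewrite mul0rn !oppr0 addr0; case: n => [|n]; rewrite ?mulr0n ?mul0rn.
Qed.

Definition dlog u := theta u / u.

Lemma dlog1 : dlog 1 = 0.
Proof. by rewrite /dlog theta1 mul0r. Qed.

Lemma dlogM u v : u \is a GRing.unit -> v \is a GRing.unit ->
  dlog (u * v) = dlog u + dlog v.
Proof.
move=> uu uv; rewrite /dlog thetaM invrM // mulrDl.
by congr (_ + _); rewrite mulrA; [rewrite mulrK | rewrite (mulrC u) -!mulrA
  (mulrCA u) divrr // mulr1].
Qed.

Lemma dlogX u r : u \is a GRing.unit -> dlog (u ^+ r) = dlog u *+ r.
Proof.
move=> uu; elim: r => [|r IHr]; first exact: dlog1.
by rewrite exprS dlogM ?unitrX // IHr mulrS.
Qed.

Lemma dlogV u : u \is a GRing.unit -> dlog u^-1 = - dlog u.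
Proof.
move=> uu; apply/eqP; rewrite -addr_eq0 -dlogM ?unitrV //.
by rewrite mulVr // dlog1.
Qed.

Lemma dlog_prod (s : seq nat) (P : pred nat) (F : nat -> fps R) :
  (forall i, P i -> F i \is a GRing.unit) ->
  \prod_(i <- s | P i) F i \is a GRing.unit /\
  dlog (\prod_(i <- s | P i) F i) = \sum_(i <- s | P i) dlog (F i).
Proof.
move=> uF; elim/big_rec2: _ => [|i y1 y2 Pi [uy <-]].
  by rewrite dlog1 unitr1.
by rewrite unitrMl ?dlogM ?uF.
Qed.

Lemma unit_1DXn k : (0 < k)%N -> 1 + fpsX R ^+ k \is a GRing.unit.
Proof. by case: k => // k _; rewrite fps_unitE /= coef_fpsXn addr0 unitr1. Qed.

Lemma unit_1BXn k : (0 < k)%N -> 1 - fpsX R ^+ k \is a GRing.unit.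
Proof.
by case: k => // k _; rewrite fps_unitE /= coef_fpsXn subr0 unitr1.
Qed.

Definition geom k : fps R := Fps (fun n => ((0 < n) && (k %| n))%N%:R).

(** For odd [k] this is [q^k / (1 - q^(2k))], half the sum of [q^k / (1 + q^k)] and
    [q^k / (1 - q^k)]. *)
Definition odd_geom k : fps R := Fps (fun n => (odd n && (k %| n))%N%:R).

Lemma geomE k : (0 < k)%N -> geom k = fpsX R ^+ k / (1 - fpsX R ^+ k).
Proof.
move=> k0; apply: canRL (mulrK (unit_1BXn k0)) _; rewrite mulrC.
apply: fpsP => n; rewrite mulrBl mul1r coef_fpsD coef_fpsN coef_fpsXnM.
rewrite coef_fpsXn /=; have [ltnk | lekn] := ltnP n k.
  rewrite subr0 ltn_eqF //; case: n ltnk => // n ltnk.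
  by rewrite gtnNdvd.
rewrite -{1 2}(subnK lekn) addn_gt0 k0 orbT dvdn_addl // subn_gt0.
have [lt_kn | ] := ltnP k n; first by rewrite subrr gtn_eqF.
by move=> lenk; rewrite (@anti_leq n k) ?lenk // eqxx subnn dvdn0 subr0.
Qed.

Lemma odd_geomE k : (0 < k)%N -> odd k ->
  odd_geom k *+ 2 = fpsX R ^+ k / (1 + fpsX R ^+ k) + fpsX R ^+ k / (1 - fpsX R ^+ k).
Proof.
move=> k0 ok; rewrite -geomE //; apply/eqP; rewrite -subr_eq; apply/eqP.
apply: canRL (mulrK (unit_1DXn k0)) _; rewrite mulrC.
apply: fpsP => n; rewrite mulrDl mul1r coef_fpsD coef_fpsXnM coef_fpsXn.
rewrite !coef_fpsD !coef_fpsN ?coef_fpsMn /=.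
have [ltnk | lekn] := ltnP n k.
  rewrite addr0 ltn_eqF //; case: n ltnk => [|n] ltnk.
    by rewrite /= !mulr0n oppr0 !addr0.
  by rewrite gtnNdvd // andbF !mulr0n oppr0 !addr0.
(* Twice [odd_geom k] minus [geom k] has coefficient 1 at odd and -1 at even positive multiples of
   [k]. Passing from [n - k] to [n] flips the parity, so the two terms cancel unless [n = k]. *)
have -> : (k %| n)%N = (k %| n - k)%N by rewrite -{1}(subnK lekn) dvdn_addl.
have -> : odd n = ~~ odd (n - k) by rewrite oddB // ok addbT negbK.
have n0 := leq_trans k0 lekn; rewrite n0 subn_gt0 /=.
have [lt_kn | ] := ltnP k n.
  rewrite gtn_eqF //; case: odd; case: dvdn => /=; ring.
move=> lenk; rewrite (@anti_leq n k) ?lenk // eqxx subnn dvdn0 /=; ring.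
Qed.

Lemma dlog_1DXn_1BXn k : (0 < k)%N -> odd k ->
  dlog (1 + fpsX R ^+ k) - dlog (1 - fpsX R ^+ k) = odd_geom k *+ (2 * k).
Proof.
move=> k0 ok; rewrite mulrnA odd_geomE // /dlog theta1DXn theta1BXn.
by rewrite mulNr opprK !mulrnAl -mulrnDl.
Qed.

End LogarithmicDerivative.

(** * Divisor sums modulo 2 and 4 *)

Section Divisors.
Local Open Scope nat_scope.
Implicit Types (f g : nat -> nat) (p a b d m n B : nat).

Lemma sum_multiples p B f : 0 < p ->
  \sum_(0 <= d < p * B | p %| d) f d = \sum_(0 <= d < B) f (p * d).
Proof.
move=> p0; elim: B => [|B IHB]; first by rewrite muln0 !big_nil.
rewrite big_nat_recr //= -IHB (@big_cat_nat _ _ _ (p * B)) /= ?leq_mul //.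
congr (_ + _); rewrite mulnS addnC big_ltn_cond; last by rewrite -addn1 leq_add2l.
rewrite dvdn_mulr // big_nat_cond big1 ?addn0 // => d.
case/andP=> /andP[lt1 lt2] /dvdnP[k Dk]; move: lt1 lt2.
by rewrite Dk [k * p]mulnC addnC -mulnS !ltn_pmul2l // ltnS => /leq_trans/[apply]; rewrite ltnn.
Qed.

(** The multiples of [p] are the [p * d]; as [f] vanishes from [B] on, letting [d] run up to [B]
    again adds only zeros, so one cutoff serves every divisor sum. *)
Lemma sum_split_dvdn p B f : 0 < p -> (forall d, B <= d -> f d = 0) ->
  \sum_(0 <= d < B) f d =
  \sum_(0 <= d < B | ~~ (p %| d)) f d + \sum_(0 <= d < B) f (p * d).
Proof.
move=> p0 fB; rewrite -sum_multiples // (bigID (fun d => p %| d)) /= addnC.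
congr (_ + _); rewrite [RHS](@big_cat_nat _ _ _ B) ?leq_pmull //=.
by rewrite [X in _ = _ + X]big_nat_cond [X in _ + X]big1 ?addn0 // => d /andP[/andP[/fB]].
Qed.

Lemma odd_sum B f g : (forall d, odd (f d) = odd (g d)) ->
  odd (\sum_(0 <= d < B) f d) = odd (\sum_(0 <= d < B) g d).
Proof.
by move=> fg; elim/big_rec2: _ => // d x y _; rewrite !oddD fg => ->.
Qed.

(* As [3 %| a], a [d] prime to 3 divides [a] iff [3 d] does: the odd divisors of
   [a] not divisible by 9 come in pairs [d], [3 d]. *)
Lemma odd_divisors_mul9 a B : 3 %| a -> 0 < a < B ->
  odd (\sum_(0 <= d < B) (odd d && (d %| a))) =
  odd (\sum_(0 <= d < B) (odd d && (9 * d %| a))).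
Proof.
move=> a3 /andP[a0 aB].
have ndvd k d : 0 < k -> B <= d -> (k * d %| a) = false.
  by move=> k0 Bd; apply/gtnNdvd => //; rewrite (leq_trans aB) // (leq_trans Bd) // leq_pmull.
rewrite (@sum_split_dvdn 3) // => [|d Bd]; last first.
  by have := ndvd 1 d isT Bd; rewrite mul1n => ->; rewrite andbF.
rewrite (@sum_split_dvdn 3 _ (fun d => odd (3 * d) && (3 * d %| a) : nat)) // => [|d Bd]; last first.
  by rewrite ndvd ?andbF.
rewrite [X in odd (X + _)](eq_bigr (fun d => odd (3 * d) && (3 * d %| a) : nat)).
  rewrite addnA addnn oddD odd_double addFb; congr odd; apply: eq_bigr => d _.
  by rewrite !oddM mulnA.
move=> d nd3; rewrite oddM /= Gauss_dvd ?a3 //.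
by rewrite prime_coprime.
Qed.

Definition sigma B n := \sum_(0 <= d < B) (d %| n) * d.

Lemma sigma_divisors B n : 0 < n < B -> sigma B n = \sum_(d <- divisors n) d.
Proof.
case/andP=> n0 nB; rewrite /sigma (eq_bigr (fun d => if d %| n then d else 0)); last first.
  by move=> d _; case: dvdn; rewrite ?mul1n.
rewrite -big_mkcond -big_filter; apply: perm_big; apply: uniq_perm.
- by rewrite filter_uniq ?iota_uniq.
- exact: divisors_uniq.
move=> d; rewrite mem_filter mem_index_iota -dvdn_divisors //=.
by case Dd: (d %| n) => //=; rewrite (leq_ltn_trans (dvdn_leq n0 Dd)).
Qed.

(* The divisors [d] and [m / d] have residues 1 and 2 modulo 3 in some order. *)
Lemma sigma_even B m : 0 < m < B -> odd m -> m %% 3 = 2 -> ~~ odd (sigma B m).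
Proof.
move=> mB om m3; have /andP[m0 _] := mB; rewrite sigma_divisors //.
have res d : d %| m -> ((m %/ d) %% 3 == 2) = (d %% 3 == 1).
  move=> /divnK Dm; have: (m %/ d) %% 3 * (d %% 3) %% 3 = 2 by rewrite modnMm Dm.
  have := ltn_pmod (m %/ d) (isT : 0 < 3); have := ltn_pmod d (isT : 0 < 3).
  by case: (d %% 3) => [|[|[|]]] //; case: (_ %% 3) => [|[|[|]]].
have res2 d : d %| m -> (d %% 3 != 1) = (d %% 3 == 2).
  move=> /divnK Dm; have: (m %/ d) %% 3 * (d %% 3) %% 3 = 2 by rewrite modnMm Dm.
  have := ltn_pmod d (isT : 0 < 3).
  by case: (d %% 3) => [|[|[|]]] //; rewrite muln0.
have divK d : d %| m -> m %/ (m %/ d) = d.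
  move=> dm; rewrite -{1}(divnK dm) mulKn //.
  by rewrite divn_gt0 ?(dvdn_leq m0 dm) // (dvdn_gt0 m0 dm).
have perm : perm_eq (divisors m) [seq m %/ d | d <- divisors m].
  have inj : {in divisors m &, injective (fun d => m %/ d)}.
    move=> d e; rewrite -!dvdn_divisors // => dm em eq_de.
    by rewrite -[d]divK // eq_de divK.
  apply: uniq_perm; rewrite ?map_inj_in_uniq ?divisors_uniq // => d.
  apply/idP/mapP => [|[e em ->]]; last by move: em; rewrite -!dvdn_divisors // => /dvdn_div.
  rewrite -dvdn_divisors // => dm.
  by exists (m %/ d); rewrite ?divK // -dvdn_divisors // dvdn_div.
rewrite (bigID (fun d => d %% 3 == 1)) /= [X in _ + X](perm_big _ perm) big_map.
rewrite big_seq_cond [X in _ + X]big_seq_cond.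
rewrite [X in _ + X](eq_bigl (fun d => (d \in divisors m) && (d %% 3 == 1))) => [|d].
  rewrite -big_split /= -dvdn2 dvdn_sum // => d /andP[]; rewrite -dvdn_divisors // => dm _.
  by rewrite dvdn2 oddD !(dvdn_odd _ om) // dvdn_div.
case dm: (d \in _) => //=; move: dm; rewrite -dvdn_divisors // => dm.
by rewrite res2 ?res // dvdn_div.
Qed.

(** The divisors of [p * m] divisible by [p] are the [p * d] with [d] dividing [m]; the others are
    the divisors of [m] prime to [p]. *)
Lemma sigma_mul p B m : prime p -> 0 < p * m < B ->
  sigma B (p * m) = p * sigma B m + \sum_(0 <= d < B | ~~ (p %| d)) (d %| m) * d.
Proof.
move=> pr_p /andP[pm0 pmB]; have p0 := prime_gt0 pr_p.
rewrite {1}/sigma (@sum_split_dvdn p) // => [|d Bd]; last first.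
  by rewrite gtnNdvd // (leq_trans pmB).
rewrite addnC /sigma big_distrr; congr (_ + _).
  by apply: eq_bigr => d _ /=; rewrite dvdn_pmul2l // mulnCA.
apply: eq_bigr => d npd; rewrite Gauss_dvdr // coprime_sym prime_coprime //.
Qed.

(** The sum factors as [(1 + p + ... + p^(2k+1))] times [sigma B m]: the first factor has an even
    number of odd terms, and the second is even. The induction advances two powers of [p] at a
    time. *)
Lemma sigma_odd_power B p m k : prime p -> odd p -> ~~ (p %| m) -> ~~ odd (sigma B m) ->
  0 < p ^ k.*2.+1 * m < B -> 4 %| sigma B (p ^ k.*2.+1 * m).
Proof.
move=> pr_p op npm sm; set r := sigma B m in sm.
have p0 := prime_gt0 pr_p.
have npmB : 0 < m < B -> \sum_(0 <= d < B | ~~ (p %| d)) (d %| m) * d = r.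
  case/andP=> m0 mB; rewrite /r /sigma (@sum_split_dvdn p) // => [|d Bd].
    rewrite [X in _ + X]big1 ?addn0 // => d _.
    case dm: (p * d %| m) => //; case/negP: npm.
    by rewrite (dvdn_trans _ dm) ?dvdn_mulr.
  by rewrite gtnNdvd // (leq_trans mB).
have npart j : 0 < p ^ j * m < B ->
    \sum_(0 <= d < B | ~~ (p %| d)) (d %| p ^ j * m) * d = r.
  case/andP=> jm0 jmB; rewrite -npmB.
  - apply: eq_bigr => d npd; rewrite Gauss_dvdr // coprime_sym.
    by rewrite coprimeXl // prime_coprime.
  move: jm0; rewrite muln_gt0 => /andP[pj0 ->] /=.
  by rewrite (leq_ltn_trans _ jmB) // leq_pmull.
have step j : 0 < p ^ j.+1 * m < B -> sigma B (p ^ j.+1 * m) = p * sigma B (p ^ j * m) + r.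
  case/andP=> h1 h2; have h2' : 0 < p ^ j * m < B.
    move: h1 h2; rewrite expnS -mulnA muln_gt0 => /andP[_ ->] /=.
    by apply: leq_ltn_trans; rewrite leq_pmull.
  by rewrite expnS -mulnA sigma_mul ?npart // mulnA -expnS h1.
have [s Dr]: exists s, r = s * 2 by apply/dvdnP; rewrite dvdn2.
have [t Dp]: exists t, p = t.*2.+1 by exists p./2; lia.
elim: k => [|k IHk] h.
  (* Here the sum is [(p + 1) * r], with [p + 1 = 2 * t.+1] and [r = 2 * s]. *)
  by rewrite step // expn0 mul1n -/r Dr Dp; apply/dvdnP; exists (s * t.+1); lia.
have h1 : 0 < p ^ k.*2.+2 * m < B.
  case/andP: h; rewrite doubleS expnS -mulnA muln_gt0 => /andP[_ ->] /=.
  by apply: leq_ltn_trans; rewrite leq_pmull.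
have h0 : 0 < p ^ k.*2.+1 * m < B.
  case/andP: h1; rewrite expnS -mulnA muln_gt0 => /andP[_ ->] /=.
  by apply: leq_ltn_trans; rewrite leq_pmull.
have /dvdnP[u Du] := IHk h0.
(* Two steps turn a sum [4 * u] into [p^2 * 4 * u + (p + 1) * r]. *)
rewrite step // step // Du Dr Dp; apply/dvdnP.
exists ((t.*2.+1) * (t.*2.+1) * u + s * t.+1); lia.
Qed.

Definition sum_dvd9 B b := \sum_(0 <= d < B) (9 * d %| b) * d.

Lemma sum_dvd9_eq0 B b : ~~ (3 %| b)%N -> sum_dvd9 B b = 0%N.
Proof.
move=> b3; apply: big1 => d _; case d9: (9 * d %| b)%N => //.
by case/negP: b3; apply: dvdn_trans d9; rewrite dvdn_mulr.
Qed.

End Divisors.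

(** This turns sums over the factors into sums over odd [d = 2k - 1], and fixes the cutoff
    [B = 2 * M - 1] used for the divisor sums below. *)
Lemma sum_odd (V : nmodType) (f : nat -> V) M :
  \sum_(1 <= k < M) f (2 * k - 1)%N = \sum_(0 <= d < 2 * M - 1 | odd d) f d.
Proof.
case: M => [|M]; first by rewrite !big_geq.
elim: M => [|M IHM]; first by rewrite big_geq // big_mkcond big_nat1.
rewrite big_nat_recr //= IHM.
have -> : (2 * M.+2 - 1 = (2 * M.+1 - 1).+2)%N by lia.
rewrite [RHS]big_mkcond !big_nat_recr //= -big_mkcond.
have -> : odd (2 * M.+1 - 1) by lia.
by rewrite addr0.
Qed.

Lemma dvdz_mulrn d (x : int) k : (d %| k%:Z)%Z -> (d %| x *+ k)%Z.
Proof. by move=> dk; rewrite -mulr_natr natz dvdz_mull. Qed.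

(** * The quadratic character of -3 and residues modulo 3 *)

Lemma sqr_eqN3_mod p : prime p -> (p %% 3 = 1)%N -> exists x : 'F_p, x ^+ 2 = - 3%:R.
Proof.
move=> pr_p p3; have cardU : #|[set: {unit 'F_p}]| = p.-1.
  by rewrite card_units_Zp ?pdiv_gt0 // pdiv_id // totient_prime.
(* The unit group has order [p - 1], a multiple of 3, so it contains an element [u] of order 3. *)
have /(Cauchy (isT : prime 3))[u _ ou] : (3 %| #|[set: {unit 'F_p}]|)%N.
  rewrite cardU; apply/dvdnP; exists (p %/ 3)%N; lia.
have u3 : (val u : 'F_p) ^+ 3 = 1.
  by rewrite -FinRing.val_unitX -ou expg_order.
have u1 : (val u : 'F_p) != 1.
  apply: contra_eqN ou => /eqP u1; rewrite (_ : u = 1%g) ?order1 //.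
  exact: val_inj.
(* From [u^2 + u + 1 = 0] follows [(2u + 1)^2 = -3]. *)
exists (2%:R * val u + 1).
have : (val u - 1) * (val u ^+ 2 + val u + 1) = 0 :> 'F_p.
  by rewrite (_ : _ * _ = val u ^+ 3 - 1); [rewrite u3 subrr | ring].
move/eqP; rewrite mulf_eq0 subr_eq0 (negPf u1) /= => /eqP u2.
have -> : (2%:R * val u + 1 : 'F_p) ^+ 2 = 4%:R * (val u ^+ 2 + val u + 1) - 3%:R by ring.
by rewrite u2 mulr0 sub0r.
Qed.

Lemma legendreN3_mod3 p : prime p -> (5 <= p)%N -> legendre (- 3%:Z) p = -1 -> (p %% 3 = 2)%N.
Proof.
move=> pr_p p5; rewrite /legendre; case: ifP => // _; case: existsP => // nex _.
have p3 : (p %% 3 != 0)%N.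
  by apply: contraL p5 => p3; have/(_ pr_p) := @dvdn_prime2 3 p isT; rewrite /dvdn p3 => /esym/eqP <-.
case p31: (p %% 3 == 1)%N; last by have := ltn_pmod p (isT : (0 < 3)%N); lia.
have [x x2] := sqr_eqN3_mod pr_p (eqP p31); case: nex.
have xp : (x < p)%N by rewrite -[X in (_ < X)%N](Fp_cast pr_p) ltn_ord.
exists (Ordinal xp) => /=; rewrite eqz_mod_dvd opprK.
have : (x ^ 2 + 3)%:R = 0 :> 'F_p by rewrite natrD natrX natr_Zp x2 addNr.
move/eqP; rewrite -(dvdn_pcharf (pchar_Fp pr_p)) => xd.
rewrite (_ : _ + _ = (x ^ 2 + 3)%N :> int) //.
Qed.

(** * Partial products: expansion modulo 4, logarithmic derivative, and the coefficient modulo 8 *)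

Section Schur9.
Local Notation q := (fpsX int).
Variable r : nat.

Lemma schur9_factor_unit k : (0 < k)%N -> schur9_factor r k \is a GRing.unit.
Proof.
move=> k0; have d0 : (0 < 2 * k - 1)%N by lia.
have d9 : (0 < 9 * (2 * k - 1))%N by lia.
by rewrite unitrMl ?unitrV ?unitrMl ?unitrX ?unit_1DXn ?unit_1BXn.
Qed.

Lemma dlog_schur9_factor k : (0 < k)%N ->
  dlog (schur9_factor r k) = (odd_geom _ (2 * k - 1) *+ (2 * (2 * k - 1))
    - odd_geom _ (9 * (2 * k - 1)) *+ (2 * (9 * (2 * k - 1)))) *+ r.
Proof.
move=> k0; have d0 : (0 < 2 * k - 1)%N by lia.
have d9 : (0 < 9 * (2 * k - 1))%N by lia.
have od : odd (2 * k - 1) by lia.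
have od9 : odd (9 * (2 * k - 1)) by lia.
rewrite /schur9_factor dlogM ?unitrV ?unitrMl ?unitrX ?unit_1DXn ?unit_1BXn //.
rewrite dlogV ?unitrMl ?unitrX ?unit_1DXn ?unit_1BXn //.
rewrite !dlogM ?unitrX ?unit_1DXn ?unit_1BXn // !dlogX ?unit_1DXn ?unit_1BXn //.
by rewrite -!dlog_1DXn_1BXn // !mulrnBl; ring.
Qed.

Lemma theta_schur9_prod M : theta (\prod_(1 <= k < M) schur9_factor r k) =
  \prod_(1 <= k < M) schur9_factor r k * \sum_(1 <= k < M) dlog (schur9_factor r k).
Proof.
(* The bound [1 <= k] is kept as a condition: at [k = 0] the exponent [2 * k - 1] truncates to 0 and
   [1 - q ^+ 0] vanishes. *)
rewrite big_nat_cond [X in _ * X]big_nat_cond.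
have [k /andP[/andP[k0 _] _]|uP <-] :=
    @dlog_prod _ (index_iota 1 M) (fun k => (1 <= k < M)%N && true) (schur9_factor r).
  exact: schur9_factor_unit.
by rewrite /dlog mulrCA divrr ?mulr1.
Qed.

(** Since [(1 + x) / (1 - x) = 1 + 2x / (1 - x)], the factor is the [r]-th power of
    [(1 + 2A) / (1 + 2B)]. Modulo 4 this quotient is [1 + 2(A + B)], and powers stay linear in
    [A + B]. *)
Lemma schur9_factor_mod4 k : (0 < k)%N -> exists Q : fps int,
  schur9_factor r k = 1 + (geom _ (2 * k - 1) + geom _ (9 * (2 * k - 1))) *+ r *+ 2 + Q *+ 4.
Proof.
move=> k0; have d0 : (0 < 2 * k - 1)%N by lia.
have d9 : (0 < 9 * (2 * k - 1))%N by lia.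
rewrite /schur9_factor; move: (2 * k - 1)%N (9 * _)%N d0 d9 => d e d0 e0.
set A := geom _ d; set B := geom _ e.
have DA : 1 + q ^+ d = (1 - q ^+ d) * (1 + A *+ 2).
  by rewrite /A geomE // mulrDr mulr1 mulrnAr mulrCA divrr ?unit_1BXn // mulr1; ring.
have DB : 1 + q ^+ e = (1 - q ^+ e) * (1 + B *+ 2).
  by rewrite /B geomE // mulrDr mulr1 mulrnAr mulrCA divrr ?unit_1BXn // mulr1; ring.
have uB : 1 + B *+ 2 \is a GRing.unit.
  by move: (unit_1DXn int e0); rewrite DB unitrMr // unit_1BXn.
rewrite -!exprMn -expr_div_n.
have -> : (1 + q ^+ d) * (1 - q ^+ e) / ((1 + q ^+ e) * (1 - q ^+ d)) = (1 + A *+ 2) / (1 + B *+ 2).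
  apply: (canLR (mulrK _)); first by rewrite unitrMl ?unit_1BXn ?unit_1DXn.
  rewrite DA DB; have := mulVr uB; move: (_^-1) => V VB.
  transitivity ((1 + A *+ 2) * (V * (1 + B *+ 2)) * (1 - q ^+ e) * (1 - q ^+ d)).
    by rewrite VB; ring.
  by ring.
have -> : (1 + A *+ 2) / (1 + B *+ 2) = 1 + (A + B) *+ 2 - ((1 + A + B) * B / (1 + B *+ 2)) *+ 4.
  apply: (canLR (mulrK uB)); rewrite mulrDl mulNr mulrnAl divrK //; ring.
set C := _ / _; elim: r => [|s [Q IHs]].
  by exists 0; rewrite !mulr0n mul0rn !addr0.
rewrite exprS IHs; exists (Q + (A + B) ^+ 2 *+ s + (A + B) * Q *+ 2 - C * (1 + (A + B) *+ s *+ 2 + Q *+ 4)).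
by rewrite mulrSr; ring.
Qed.

Lemma schur9_prod_mod4 M : exists Q : fps int,
  \prod_(1 <= k < M) schur9_factor r k =
  1 + (\sum_(1 <= k < M) (geom _ (2 * k - 1) + geom _ (9 * (2 * k - 1)))) *+ r *+ 2 + Q *+ 4.
Proof.
elim: M => [|M [Q IHM]].
  by exists 0; rewrite !big_geq // !mul0rn !addr0.
case: M IHM => [_ |M IHM]; first by exists 0; rewrite !big_geq // !mul0rn !addr0.
rewrite big_nat_recr //= [X in X *+ r]big_nat_recr //= IHM.
have [Q' ->] := schur9_factor_mod4 (ltn0Sn M).
set A := \sum_(_ <= _ < _) _; set B := geom _ _ + geom _ _.
exists (Q + Q' + A * B *+ (r * r) + (A * Q' + B * Q) *+ r *+ 2 + Q * Q' *+ 4).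
by ring.
Qed.
Lemma coef_schur9_prod_even M a : (0 < a)%N ->
  (2 %| (\prod_(1 <= k < M) schur9_factor r k) a)%Z.
Proof.
move=> a0; have [Q ->] := schur9_prod_mod4 M.
rewrite coef_fpsD [X in _ + X]coef_fpsMn coef_fpsD coef_fps1 gtn_eqF // add0r !coef_fpsMn.
by apply: rpredD; apply: dvdz_mulrn.
Qed.

Lemma coef_schur9_prod_mod4 M a : (3 %| a)%N -> (0 < a < M)%N ->
  (4 %| (\prod_(1 <= k < M) schur9_factor r k) a)%Z.
Proof.
move=> a3 /andP[a0 aM]; have [Q ->] := schur9_prod_mod4 M.
rewrite coef_fpsD [X in _ + X]coef_fpsMn coef_fpsD coef_fps1 gtn_eqF // add0r !coef_fpsMn.
apply: rpredD; last exact: dvdz_mulrn.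
(* The cutoff exceeds [a], so no divisor of [a] is lost. *)
have aB : (0 < a < 2 * M - 1)%N by lia.
have := odd_divisors_mul9 a3 aB.
set S1 := \sum_(_ <= _ < _) _; set S9 := (X in _ = odd X) => odd19.
have -> : (\sum_(1 <= k < M) (geom int (2 * k - 1) + geom int (9 * (2 * k - 1)))) a = (S1 + S9)%:R.
  rewrite (sum_odd (fun d => geom int d + geom int (9 * d))) coef_fps_sum /S1 /S9.
  rewrite -big_split natr_sum big_mkcond; apply: eq_bigr => d _ /=.
  by rewrite a0 natrD; case: odd; rewrite ?addr0.
have /dvdnP[t ->] : (2 %| S1 + S9)%N by rewrite dvdn2 oddD odd19 addbb.
rewrite mulrnAC -mulrnA -mulrnA natz; apply/dvdzP; exists (t * r)%:Z; lia.
Qed.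

Lemma coef_dlog_schur9 M b : (\sum_(1 <= k < M) dlog (schur9_factor r k)) b =
  if odd b then ((sigma (2 * M - 1) b)%:Z - 9 * (sum_dvd9 (2 * M - 1) b)%:Z) *+ (2 * r) else 0.
Proof.
rewrite big_nat_cond (eq_bigr (fun k => (odd_geom int (2 * k - 1) *+ (2 * (2 * k - 1))
    - odd_geom int (9 * (2 * k - 1)) *+ (2 * (9 * (2 * k - 1)))) *+ r)); last first.
  by move=> k /andP[/andP[k0 _] _]; rewrite dlog_schur9_factor.
rewrite -big_nat_cond (sum_odd (fun d => (odd_geom int d *+ (2 * d)
    - odd_geom int (9 * d) *+ (2 * (9 * d))) *+ r)) coef_fps_sum.
case ob: (odd b); last first.
  rewrite big1 // => d _; rewrite coef_fpsMn coef_fpsD coef_fpsN !coef_fpsMn /= ob.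
  by rewrite !mul0rn.
rewrite /sigma /sum_dvd9 -!natz !natr_sum big_distrr /= -sumrB -sumrMnl big_mkcond.
apply: eq_bigr => d _; rewrite coef_fpsMn coef_fpsD coef_fpsN !coef_fpsMn /= ob /=.
case od: (odd d).
  by rewrite !natrM mulrnBl; ring.
(* An odd [b] has no even divisor, so restricting to odd [d] loses nothing. *)
have -> : (d %| b)%N = false by apply: contraFF od => /dvdn_odd; apply.
have -> : (9 * d %| b)%N = false.
  by apply: contraFF od => /dvdn_odd/(_ ob); rewrite oddM.
by rewrite !mul0n mulr0 subr0 mul0rn.
Qed.

Lemma coef_dlog_schur9_mod4 M b : (b %% 3 != 1)%N -> (0 < b < M)%N ->
  (4 %| (\sum_(1 <= k < M) dlog (schur9_factor r k)) b)%Z.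
Proof.
move=> b3 bM; rewrite coef_dlog_schur9; case ob: (odd b) => //.
have bB : (0 < b < 2 * M - 1)%N by lia.
rewrite mulrnA -[_ *+ r]mulr_natr; set B := (2 * M - 1)%N in bB *.
(* The coefficient carries a factor 2 already; equal parities of the two sums supply the other. *)
suff odd_eq : odd (sigma B b) = odd (sum_dvd9 B b).
  have := odd_double_half (sigma B b); have := odd_double_half (sum_dvd9 B b).
  rewrite odd_eq; move: (odd _) (_./2) (_./2) => e s t <- <-.
  apply: dvdz_mulr; apply/dvdzP; exists (s%:Z - 9 * t%:Z - 4 * (e : nat)%:Z); case: e => /=; lia.
have [b30 | nb3] := boolP (3 %| b)%N; last first.
  rewrite sum_dvd9_eq0 //; apply/negbTE/sigma_even => //.
  by move: nb3 (ltn_pmod b (isT : (0 < 3)%N)); lia.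
(* Modulo 2 the weight [d] just selects the odd [d], so weighted sums become counts of odd
   divisors. *)
have parity k : odd (\sum_(0 <= d < B) (k * d %| b) * d) = odd (\sum_(0 <= d < B) (odd d && (k * d %| b))).
  by apply: odd_sum => d; rewrite oddM andbC; case: odd; case: dvdn.
rewrite /sum_dvd9 parity -odd_divisors_mul9 //.
by have := parity 1%N; under eq_bigr do rewrite mul1n; under [in RHS]eq_bigr do rewrite mul1n.
Qed.

Lemma schur9_coef_mod8 M N : odd N -> (N %% 3 = 1)%N -> (N < M)%N ->
  (4 %| sigma (2 * M - 1) N)%N -> (8 %| (\prod_(1 <= k < M) schur9_factor r k) N)%Z.
Proof.
move=> oN N3 NM sN; set P := \prod_(_ <= _ < _) _.
have N0 : (0 < N)%N by case: N oN {N3 NM sN}.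
(* As [N] is odd, the coefficient may be multiplied by [N], which gives that of [theta P]. *)
have cop : coprimez 8 N by rewrite coprimezE -[`|8|%N]/(2 ^ 3)%N coprimeXl // coprime2n.
rewrite -(Gauss_dvdzl _ cop) -[N%:Z]natz mulr_natr -[_ *+ _]/((theta P) N).
rewrite theta_schur9_prod coef_fpsM rpred_sum // => -[i /= /ltnSE le_iN] _.
have [-> | i0] := posnP i.
  (* Since 3 does not divide [N], the 9-part vanishes and the coefficient is [2 * r * sigma], with 4
     dividing [sigma]. *)
  rewrite subn0 dvdz_mull // coef_dlog_schur9 oN sum_dvd9_eq0 ?mulr0 ?subr0; last by rewrite /dvdn N3.
  case/dvdnP: sN => t ->; apply/dvdzP; exists (t * r)%:Z; rewrite -mulr_natr natz; lia.
case ob: (odd (N - i)); last by rewrite coef_dlog_schur9 ob mulr0.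
have bM : (0 < N - i < M)%N by move: ob; case: (N - i)%N (leq_subr i N) => //; lia.
have [b3 | b3] := eqVneq ((N - i) %% 3)%N 1%N.
  apply: (@dvdz_mul 4 2); first by rewrite coef_schur9_prod_mod4; lia.
  by rewrite coef_dlog_schur9 ob dvdz_mulrn // PoszM dvdz_mulr.
by apply: (@dvdz_mul 2 4); [exact: coef_schur9_prod_even | exact: coef_dlog_schur9_mod4].
Qed.
End Schur9.

(** * Arithmetic of the progression *)

Theorem theorem3p9 (p m alpha n i : nat)
    (p_prime : prime p) (p_ge5 : (5 <= p)%N)
    (legendre_p : legendre (- 3%:Z) p = -1)
    (i_range : (1 <= i <= p - 1)%N) :
  (schur9_overpartitions (4 * m + 1)
     (6 * p ^ (2 * alpha + 2) * n + (6 * i + p) * p ^ (2 * alpha + 1))%N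
   = 0 %[mod 8])%Z.
Proof.
have p3 := legendreN3_mod3 p_prime p_ge5 legendre_p.
have op : odd p by apply: contraLR p_ge5; case/even_prime: p_prime => [-> | ->].
set K := (6 * p * n + 6 * i + p)%N.
have -> : (6 * p ^ (2 * alpha + 2) * n + (6 * i + p) * p ^ (2 * alpha + 1) = p ^ alpha.*2.+1 * K)%N.
  by rewrite !mul2n addn1 addn2 /K [in LHS]expnS; nia.
have K3 : (K %% 3 = 2)%N.
  by rewrite /K -!mulnA -[6%N]/(3 * 2)%N -!mulnA -mulnDr mulnC modnMDl.
have oK : odd K by rewrite /K -!mulnA -mulnDr oddD oddM op.
(* Modulo [p], [K] is [6 * i], and [p] divides none of 2, 3 and [i]. *)
have npK : ~~ (p %| K)%N.
  rewrite /K dvdn_addl // dvdn_addr; last by rewrite mulnAC dvdn_mull.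
  by rewrite (_ : 6 = 2 * 3)%N // !Euclid_dvdM // !gtnNdvd; lia.
set N := (_ * K)%N.
have oN : odd N by rewrite oddM oddX op oK orbT.
have N3 : (N %% 3 = 1)%N.
  (* Both [K] and the odd power of [p] are 2 modulo 3. *)
  rewrite -modnMm K3 -modnXm p3 (_ : 2 ^ _ %% 3 = 2)%N //.
  by rewrite expnS -mul2n expnM -modnMmr -modnXm exp1n.
have N0 : (0 < N)%N by case: N oN {N3}.
have [M0 PM] := schur9_prod_cvg (4 * m + 1) N.
(* The partial product is taken long enough for coefficient [N] to have stabilised and for the
   cutoff to exceed [N]. *)
rewrite /schur9_overpartitions -(PM (maxn M0 N.+1)) ?leq_maxl //.
apply/eqP; rewrite eqz_mod_dvd subr0.
have NM : (N < maxn M0 N.+1)%N by rewrite leq_maxr.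
apply: schur9_coef_mod8 => //.
apply: sigma_odd_power => //; last by lia.
apply: sigma_even => //.
have : (K <= N)%N by rewrite leq_pmull // expn_gt0 prime_gt0.
by move: N0; rewrite {1}/N muln_gt0 => /andP[_ K0]; lia.
Qed.
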